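(* Let $A$ be a linear transformation of a vector space $M$ of infinite dimension, and let $M_0$ be the Fitting null component of $A$, i.e. the set of all $x\in M$ with $xA^m=0$ for some positive integer $m$ (depending on $x$). If $M/M_0$ has finite dimension, then $M$ is a direct sum $M=M_0\oplus M_1$, where $M_1$ is a finite-dimensional subspace invariant under $A$ and the transformation induced by $A$ in $M_1$ is an automorphism of $M_1$.
   Context: Linear transformations are written on the right: $xA$ denotes the image of $x$ under $A$. *)

(* Defs.v *)
From HB Require Import structures.
From mathcomp Require Import all_boot all_algebra.
From mathcomp Require Import boolp.

Set Implicit Arguments.
Unset Strict Implicit.
Unset Printing Implicit Defensive.

Import GRing.Theory.
Local Open Scope ring_scope.
Local Open Scope quotient_scope.

(* [Vector.axiom n V] is the type of linear bijections from [V] onto the space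
   of row vectors with [n] entries; it is the library's axiom for a vector space
   to be finite dimensional, of dimension [n]. *)
Definition finite_dim (F : fieldType) (V : lmodType F) : Prop :=
  exists n : nat, inhabited (Vector.axiom n V).

Section Subspace.
Variables (F : fieldType) (V : lmodType F) (W : submodClosed V).

Record subspace : Type := Subspace {
  subspace_val : V;
  subspace_valP : subspace_val \in W
}.

HB.instance Definition _ := [isSub for subspace_val].
HB.instance Definition _ := [Choice of subspace by <:].
HB.instance Definition _ := [SubChoice_isSubLmodule of subspace by <:].

End Subspace.

Section QuotientSpace.
Variables (F : fieldType) (V : lmodType F) (W : submodClosed V).

(* [submodClosed V] does not inherit from [zmodClosed V], which the library
   quotient expects. *)
Definition zmod_pred : {pred V} := W.

Lemma zmod_pred_closed : zmod_closed zmod_pred.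
Proof. exact: GRing.submod_closedB (submodClosedP W). Qed.

HB.instance Definition _ :=
  GRing.isZmodClosed.Build V zmod_pred zmod_pred_closed.

Definition quotient_space : Type := Quotient.quot zmod_pred.

HB.instance Definition _ := GRing.Zmodule.on quotient_space.
HB.instance Definition _ := EqQuotient.on quotient_space.

Definition quotient_scale (a : F) (u : quotient_space) : quotient_space :=
  \pi_quotient_space (a *: repr u).

Lemma quotient_piP (x y : V) :
  (\pi_quotient_space x = \pi_quotient_space y) <-> (x - y \in W).
Proof.
rewrite -[x - y \in W]/(x - y \in zmod_pred) Quotient.idealrBE.
by split=> /eqP.
Qed.

Lemma quotient_piD (x y : V) :
  \pi_quotient_space (x + y) = \pi_quotient_space x + \pi_quotient_space y.
Proof. exact: (@Quotient.pi_add _ zmod_pred). Qed.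

Lemma quotient_piZ (a : F) (x : V) :
  \pi_quotient_space (a *: x) = quotient_scale a (\pi_quotient_space x).
Proof.
apply/quotient_piP; rewrite -scalerBr rpredZ //.
by apply: (proj1 (quotient_piP _ _)); rewrite reprK.
Qed.

Lemma quotient_scaleA a b u :
  quotient_scale a (quotient_scale b u) = quotient_scale (a * b) u.
Proof. by rewrite -[u]reprK -!quotient_piZ scalerA reprK. Qed.

Lemma quotient_scale1 : left_id 1 quotient_scale.
Proof. by move=> u; rewrite -[u]reprK -quotient_piZ scale1r. Qed.

Lemma quotient_scaleDr : right_distributive quotient_scale +%R.
Proof.
move=> a u v; rewrite -[u]reprK -[v]reprK -quotient_piD -!quotient_piZ.
by rewrite scalerDr quotient_piD.
Qed.

Lemma quotient_scaleDl u : {morph quotient_scale^~ u : a b / a + b}.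
Proof.
by move=> a b; rewrite -[u]reprK -!quotient_piZ scalerDl quotient_piD.
Qed.

HB.instance Definition _ := GRing.Zmodule_isLmodule.Build F quotient_space
  quotient_scaleA quotient_scale1 quotient_scaleDr quotient_scaleDl.

End QuotientSpace.

Definition direct_sum (F : fieldType) (V : lmodType F)
    (U W : submodClosed V) : Prop :=
  forall x : V, exists! p : V * V,
    [/\ p.1 \in U, p.2 \in W & x = p.1 + p.2].

Definition invariant_subspace (F : fieldType) (V : lmodType F)
    (A : {linear V -> V}) (W : submodClosed V) : Prop :=
  forall x : V, x \in W -> A x \in W.

Section Induced.
Variables (F : fieldType) (V : lmodType F) (A : {linear V -> V}).
Variables (W : submodClosed V) (invW : invariant_subspace A W).

Definition induced (u : subspace W) : subspace W :=
  Sub (A (val u)) (invW (valP u)).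

Lemma induced_is_linear : linear induced.
Proof. by move=> a u v; apply: val_inj; rewrite /= !linearP. Qed.

HB.instance Definition _ :=
  GRing.isLinear.Build F (subspace W) (subspace W) _ induced induced_is_linear.

End Induced.

Definition automorphism (F : fieldType) (V : lmodType F)
  (f : {linear V -> V}) : Prop := bijective f.

Section FittingNull.
Variables (F : fieldType) (V : lmodType F) (A : {linear V -> V}).

Definition fitting_null : {pred V} :=
  [pred x | `[< exists m : nat, (0 < m)%N /\ iter m A x = 0 >]].

Lemma fitting_nullP (x : V) :
  reflect (exists m : nat, (0 < m)%N /\ iter m A x = 0) (x \in fitting_null).
Proof. exact: asboolP. Qed.

Lemma iter_linearP (m : nat) (a : F) (x y : V) :
  iter m A (a *: x + y) = a *: iter m A x + iter m A y.
Proof. by elim: m => //= m ->; rewrite linearP. Qed.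

Lemma fitting_null_submod_closed : submod_closed fitting_null.
Proof.
have iter0 m : iter m A 0 = 0 by elim: m => //= m ->; rewrite linear0.
split=> [|a x y /fitting_nullP[m [m0 xm]] /fitting_nullP[n [n0 yn]]].
  by apply/fitting_nullP; exists 1%N; split; rewrite ?iter0.
apply/fitting_nullP; exists (m + n)%N; split; first by rewrite addn_gt0 m0.
rewrite iter_linearP [in X in X + _]addnC !iterD xm yn !iter0.
by rewrite scaler0 addr0.
Qed.

HB.instance Definition _ :=
  GRing.isSubmodClosed.Build F V fitting_null fitting_null_submod_closed.

End FittingNull.

(* Main.v *)
Require Import Defs.
From HB Require Import structures.
From mathcomp Require Import all_boot all_algebra.
From mathcomp Require Import boolp.

(** Write [M0] for the Fitting null component.  If [A x] lies in [M0] then so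
    does [x], so [A] induces an injective, hence invertible, map of the
    finite-dimensional space [M / M0]; in coordinates [phi : M -> 'rV_n] with
    kernel [M0] this map is an invertible matrix [B].  Let [s] be any linear
    section of [phi].  It need not commute with the two actions, but the defect
    [A (s r) - s (r *m B)] always lies in [M0], and it is linear in [r], so one
    power [A^k] kills it for all [r] at once (lemma [common_exponent]).
    Therefore [r |-> A^k (s r)] intertwines [B] with [A]; modulo [M0] it is
    [B^k], and precomposing with [B^-k] gives a section [u] of [phi] such that
    [A (u r) = u (r *m B)] (lemma [equivariant_section]).  The image of [u] is
    the required [M1]: it is a complement of the kernel [M0] of [phi], and [u]
    identifies the action of [A] on it with that of the invertible matrix [B]. *)

Set Implicit Arguments.
Unset Strict Implicit.
Unset Printing Implicit Defensive.

Import GRing.Theory.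
Local Open Scope ring_scope.
Local Open Scope quotient_scope.

(** The implication from left to right is what makes the map induced by [A] on
    the quotient by the null component injective. *)
Lemma fitting_null_image (F : fieldType) (M : lmodType F)
    (A : {linear M -> M}) (x : M) :
  (A x \in fitting_null A) = (x \in fitting_null A).
Proof.
apply/fitting_nullP/fitting_nullP => -[m [m_gt0 xm0]].
  by exists m.+1; rewrite iterSr.
by exists m; rewrite -iterSr iterS xm0 linear0.
Qed.

(** Coordinates on the finite-dimensional quotient, read on the whole space; the
    section comes from lifting a basis of the quotient. *)
Lemma finite_codim_coordinates (F : fieldType) (M : lmodType F)
    (W : submodClosed M) :
  finite_dim (quotient_space W) ->
  exists n (phi : {linear M -> 'rV[F]_n}) (s : {linear 'rV[F]_n -> M}),
    cancel s phi /\ forall x, (phi x == 0) = (x \in W).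
Proof.
move=> [n [[v2r v2r_lin [r2v v2rK r2vK]]]].
pose f (x : M) := v2r (\pi_(quotient_space W) x).
have f_lin : linear f.
  by move=> a x y; rewrite /f quotient_piD quotient_piZ v2r_lin.
pose phi : {linear M -> 'rV[F]_n} :=
  HB.pack f (GRing.isLinear.Build F M 'rV[F]_n _ f f_lin).
pose g (r : 'rV[F]_n) := \sum_i r 0 i *: repr (r2v (delta_mx 0 i)).
have g_lin : linear g.
  move=> a r t; rewrite /g scaler_sumr -big_split; apply: eq_bigr => i _.
  by rewrite !mxE scalerDl scalerA.
pose s : {linear 'rV[F]_n -> M} :=
  HB.pack g (GRing.isLinear.Build F 'rV[F]_n M _ g g_lin).
exists n, phi, s; split=> [r|x].
  rewrite [RHS]row_sum_delta [s r]/(g r) linear_sum; apply: eq_bigr => i _.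
  by rewrite linearZ; congr (_ *: _); rewrite [LHS]/(f _) /f reprK r2vK.
have <- : phi 0 = 0 by rewrite linear0.
rewrite [phi x]/(f x) [phi 0]/(f 0) (can_eq v2rK).
by apply/eqP/idP => [/quotient_piP|xW]; [|apply/quotient_piP]; rewrite subr0.
Qed.

(** The exponent killing a vector of the null component depends on the vector;
    it is uniform on a finite-dimensional subspace, where it suffices to kill a
    spanning family. *)
Lemma common_exponent (F : fieldType) (M : lmodType F) (A : {linear M -> M})
    (n : nat) (d : {linear 'rV[F]_n -> M}) :
  (forall r, d r \in fitting_null A) ->
  exists k, forall r, iter k A (d r) = 0.
Proof.
move=> d_null.
have /choice[m m_kills] i : exists m, iter m A (d (delta_mx 0 i)) = 0.
  by have /fitting_nullP[m [_ ?]] := d_null (delta_mx 0 i); exists m.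
have iter0 j : iter j A 0 = 0 by elim: j => //= j ->; rewrite linear0.
exists (\max_i m i)%N => r; set k := (\max_i m i)%N.
rewrite [r]row_sum_delta linear_sum.
apply: (big_ind (fun x => iter k A x = 0)) => // [x y xk yk|i _].
  by rewrite -[x]scale1r iter_linearP xk yk scaler0 addr0.
have i_le_k : (m i <= k)%N by apply: leq_bigmax.
rewrite linearZ_LR -[_ *: _]addr0 iter_linearP iter0 addr0.
by rewrite -(subnK i_le_k) iterD m_kills iter0 scaler0.
Qed.

(** A linear section of the coordinates on [M / M0] can be corrected by a power
    of [A] so as to commute with the actions of [A] on [M] and on [M / M0]. *)
Lemma equivariant_section (F : fieldType) (M : lmodType F)
    (A : {linear M -> M}) (n : nat)
    (phi : {linear M -> 'rV[F]_n}) (s : {linear 'rV[F]_n -> M}) :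
  cancel s phi -> (forall x, (phi x == 0) = (x \in fitting_null A)) ->
  exists (B : 'M[F]_n) (u : {linear 'rV[F]_n -> M}),
    [/\ B \in unitmx, cancel u phi & forall r, A (u r) = u (r *m B)].
Proof.
move=> sK phi_null.
pose B := lin1_mx (phi \o (A \o s)).
have sB r : phi (A (s r)) = r *m B by rewrite mul_rV_lin1.
(* [x] and [s (phi x)] differ by a null vector, hence so do their images. *)
have phiB x : phi (A x) = phi x *m B.
  apply/eqP; rewrite -sB -subr_eq0 -!linearB phi_null fitting_null_image.
  by rewrite -phi_null linearB sK subrr.
have B_unit : B \in unitmx.
  rewrite -row_free_unit; apply: inj_row_free => r /eqP.
  by rewrite -sB phi_null fitting_null_image -phi_null sK => /eqP.
pose defect r := A (s r) - s (r *m B).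
have defect_lin : linear defect.
  move=> a r t; rewrite /defect mulmxDl -scalemxAl !linearP.
  by rewrite scalerDr addrACA.
pose d : {linear 'rV[F]_n -> M} :=
  HB.pack defect (GRing.isLinear.Build F 'rV[F]_n M _ defect defect_lin).
have [k kP] : exists k, forall r, iter k A (d r) = 0.
  by apply: common_exponent => r; rewrite -phi_null linearB sB sK subrr.
have iter_phi j x : phi (iter j A x) = iter j (mulmxr B) (phi x).
  by elim: j => //= j <-; rewrite phiB.
have As r : A (iter k A (s r)) = iter k A (s (r *m B)).
  have -> : A (iter k A (s r)) = iter k A (A (s r)) by rewrite -iterS iterSr.
  have -> : A (s r) = 1 *: d r + s (r *m B) by rewrite scale1r subrK.
  by rewrite iter_linearP kP scaler0 add0r.
(* Modulo the null component, [iter k A \o s] is [B ^ k] and not the identity: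
   precomposing with [B ^ (- k)] restores a section. *)
pose v r := iter k A (s (iter k (mulmxr (invmx B)) r)).
have iterV_lin j : linear (iter j (mulmxr (invmx B)) : 'rV_n -> 'rV_n).
  by move=> a r t; rewrite iter_linearP.
have v_lin : linear v.
  by move=> a r t; rewrite /v iterV_lin linearP iter_linearP.
pose u : {linear 'rV[F]_n -> M} :=
  HB.pack v (GRing.isLinear.Build F 'rV[F]_n M _ v v_lin).
exists B, u; split=> // r; rewrite [u _]/(v _) /v.
  rewrite iter_phi sK; elim: (k) => // j IHj.
  by rewrite iterSr iterS [mulmxr B _]mulmxKV.
rewrite As [u _]/(v _) /v; congr (iter k A (s _)).
by elim: (k) => //= j <-; rewrite mulmxKV // mulmxK.
Qed.

Section SectionImage.
Variables (F : fieldType) (M : lmodType F) (n : nat).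
Variables (phi : {linear M -> 'rV[F]_n}) (u : {linear 'rV[F]_n -> M}).

(** When [u] is a section of [phi], its image is the fixed space of the
    projector [u \o phi]; this form makes membership decidable. *)
Definition section_image : {pred M} := [pred x | u (phi x) == x].

Lemma section_imageP (x : M) : reflect (u (phi x) = x) (x \in section_image).
Proof. exact: eqP. Qed.

Lemma section_image_submod_closed : submod_closed section_image.
Proof.
split=> [|a x y /section_imageP ux /section_imageP uy]; apply/section_imageP.
  by rewrite !linear0.
by rewrite !linearP ux uy.
Qed.

HB.instance Definition _ :=
  GRing.isSubmodClosed.Build F M section_image section_image_submod_closed.

Hypothesis uK : cancel u phi.

Lemma section_in_image (r : 'rV[F]_n) : u r \in section_image.
Proof. by apply/section_imageP; rewrite uK. Qed.

Lemma direct_sum_section_image (W : submodClosed M) :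
  (forall x, (phi x == 0) = (x \in W)) -> direct_sum W section_image.
Proof.
move=> phiW x; exists (x - u (phi x), u (phi x)); split.
  split=> /=; [|exact: section_in_image|by rewrite subrK].
  by rewrite -phiW linearB uK subrr.
move=> [y z] [/=]; rewrite -phiW => /eqP y0 /section_imageP zE ->.
by rewrite linearD y0 add0r zE addrK.
Qed.

Lemma finite_dim_section_image : finite_dim (subspace section_image).
Proof.
exists n; constructor; exists (phi \o val).
  by move=> a x y; rewrite /= !linearP.
exists (fun r => Sub (u r) (section_in_image r)) => [x|r] /=.
  by apply: val_inj; rewrite /=; apply/section_imageP/valP.
exact: uK.
Qed.

Lemma automorphism_section_image (A : {linear M -> M}) (B : 'M[F]_n) :
  B \in unitmx -> (forall r, A (u r) = u (r *m B)) ->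
  exists invM1 : invariant_subspace A section_image,
    automorphism (induced invM1).
Proof.
move=> B_unit uB.
have inv : invariant_subspace A section_image.
  by move=> x /section_imageP <-; rewrite uB section_in_image.
exists inv.
exists (fun x => Sub (u (phi (val x) *m invmx B)) (section_in_image _)) => x;
  apply: val_inj => /=; have /section_imageP xE := valP x.
  by rewrite -[in LHS]xE uB uK mulmxK.
by rewrite uB mulmxKV.
Qed.

End SectionImage.

Theorem lemma1 (F : fieldType) (M : lmodType F) (A : {linear M -> M})
    (M_infinite : ~ finite_dim M)
    (quotient_finite : finite_dim (quotient_space (fitting_null A))) :
  exists M1 : submodClosed M,
    [/\ direct_sum (fitting_null A) M1,
        finite_dim (subspace M1) &
        exists invM1 : invariant_subspace A M1, automorphism (induced invM1)].
Proof.
have [n [phi [s [sK phi_null]]]] := finite_codim_coordinates quotient_finite.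
have [B [u [B_unit uK uB]]] := equivariant_section sK phi_null.
exists (section_image phi u : submodClosed M); split.
- exact: direct_sum_section_image.
- exact: finite_dim_section_image.
- exact: automorphism_section_image B_unit uB.
Qed.
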